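(* Let $\phi:\mathbb{R}^N\to\mathbb{R}\cup\{+\infty\}$ be a proper, lower semicontinuous, convex, inf-compact function. Let $\epsilon>0$ and $\Lambda>0$. Then the solution $u^\epsilon(\cdot,\lambda)$ of the viscous Hamilton–Jacobi equation $$\frac{\partial}{\partial\lambda}u^\epsilon+\frac12\|\nabla_x u^\epsilon\|^2=\frac{\epsilon}{2}\Delta_x u^\epsilon\ \text{ in }\mathbb{R}^N\times(0,\Lambda],\qquad u^\epsilon(x,0)=\phi(x)\ \text{ on }\mathbb{R}^N\times\{0\},$$ is proper, lower semicontinuous, convex and inf-compact for all $\lambda\in[0,\Lambda]$.
   Context: A function $h:\mathbb{R}^N\to\mathbb{R}\cup\{+\infty\}$ is proper if it is not identically $+\infty$ (and never takes the value $-\infty$). It is inf-compact if its level sets $\{h\le\alpha\}$ are compact for all $\alpha\in\mathbb{R}$. The solution meant is the one given by the Cole–Hopf change of variables: for $\lambda\in(0,\Lambda]$, $$u^\epsilon(x,\lambda)=-\epsilon\log\left(\frac{1}{(2\pi\epsilon\lambda)^{N/2}}\int_{\mathbb{R}^N}\exp\left(-\frac{1}{\epsilon}\phi(y)-\frac{1}{2\epsilon\lambda}\|x-y\|^2\right)dy\right),$$ and $u^\epsilon(\cdot,0)=\phi$.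
   Formalization: For λ > 0, properness is claimed only when the domain {φ < +∞} has nonempty interior; otherwise it fails (φ = 0 at one point of R and +∞ elsewhere gives u ≡ +∞). Lower semicontinuity, convexity and inf-compactness are stated without this condition. *)

(* Defs.v *)
From HB Require Import structures.
From mathcomp Require Import all_boot all_order all_algebra.
From mathcomp Require Import all_classical all_reals all_analysis.

Set Implicit Arguments.
Unset Strict Implicit.
Unset Printing Implicit Defensive.

Import Order.TTheory GRing.Theory Num.Theory.
Import numFieldNormedType.Exports.

Local Open Scope classical_set_scope.
Local Open Scope ring_scope.

(* The product of a measure on T and a measure on n-tuples over T,
   transported to n.+1-tuples. *)
Section cons_measure.
Context d (T : measurableType d) (R : realType) (n : nat).
Variable m1 : {sigma_finite_measure set T -> \bar R}.
Variable m2 : {sigma_finite_measure set (n.-tuple T) -> \bar R}.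

Definition cons_pair (x : T * n.-tuple T) : n.+1.-tuple T :=
  [tuple of x.1 :: x.2].

Let split_tuple (y : n.+1.-tuple T) : T * n.-tuple T :=
  (thead y, [tuple of behead y]).

Let cons_pairK : cancel cons_pair split_tuple.
Proof. by case=> x y; congr pair; apply/val_inj. Qed.

Lemma measurable_cons_pair : measurable_fun setT cons_pair.
Proof. exact: (measurable_cons measurable_fst measurable_snd). Qed.

Let measurable_split_tuple : measurable_fun setT split_tuple.
Proof.
apply: measurable_fun_pair; last exact: measurable_behead.
exact: (@measurable_tnth _ T n.+1 ord0).
Qed.

Definition cons_measure : set (n.+1.-tuple T) -> \bar R :=
  pushforward (m1 \x m2)%E cons_pair.

Let measurable_preimage_cons A : measurable A -> measurable (cons_pair @^-1` A).
Proof.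
by move=> mA; rewrite -[X in measurable X]setTI; exact: measurable_cons_pair.
Qed.

Let cons_measure0 : cons_measure set0 = 0%E.
Proof. by rewrite /cons_measure /pushforward preimage_set0 measure0. Qed.

Let cons_measure_ge0 A : (0 <= cons_measure A)%E.
Proof. exact: (measure_ge0 (m1 \x m2)%E). Qed.

Let cons_measure_sigma_additive : semi_sigma_additive cons_measure.
Proof.
move=> F mF tF mUF; rewrite /cons_measure /pushforward preimage_bigcup.
apply: measure_semi_sigma_additive.
- by move=> k; exact: measurable_preimage_cons.
- apply/trivIsetP => /= i j _ _ ij; rewrite -preimage_setI.
  by move/trivIsetP : tF => /(_ _ _ _ _ ij) ->//; rewrite preimage_set0.
- by rewrite -preimage_bigcup; exact: measurable_preimage_cons.
Qed.

HB.instance Definition _ := isMeasure.Build _ _ _ cons_measure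
  cons_measure0 cons_measure_ge0 cons_measure_sigma_additive.

Let cons_measure_sigma_finite : sigma_finite setT cons_measure.
Proof.
have /sigma_finiteP[F [TF ndF Foo]] := sigma_finiteT m1.
have /sigma_finiteP[G [TG ndG Goo]] := sigma_finiteT m2.
exists (fun k => split_tuple @^-1` (F k `*` G k)).
  rewrite -preimage_bigcup (_ : \bigcup_k _ = setT) ?preimage_setT//.
  apply/seteqP; split => // -[x y] _.
  have [i _ Fix] : (\bigcup_k F k) x by rewrite -TF.
  have [j _ Gjy] : (\bigcup_k G k) y by rewrite -TG.
  exists (maxn i j) => //; split => /=.
    by move: x Fix; exact/subsetPset/ndF/leq_maxl.
  by move: y Gjy; exact/subsetPset/ndG/leq_maxr.
move=> k; have [mF Fk] := Foo k; have [mG Gk] := Goo k; split.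
  rewrite -[X in measurable X]setTI; apply: measurable_split_tuple => //.
  exact: measurableX.
rewrite /cons_measure /pushforward -comp_preimage.
rewrite (_ : _ \o _ = id) ?preimage_id//; last first.
  by apply/funext => x; exact: cons_pairK.
by rewrite product_measure1E// lte_mul_pinfty// ge0_fin_numE.
Qed.

HB.instance Definition _ :=
  Measure_isSigmaFinite.Build _ _ _ cons_measure cons_measure_sigma_finite.

End cons_measure.

(* Lebesgue measure on R^N, i.e. the N-fold product of [lebesgue_measure]. *)
Fixpoint lebesgue_tuple (R : realType) (N : nat) :
    {sigma_finite_measure set (N.-tuple (measurableTypeR R)) -> \bar R} :=
  match N with
  | 0 => \d_[tuple]
  | n.+1 => cons_measure (@lebesgue_measure R) (lebesgue_tuple R n)
  end.

Lemma lebesgue_tuple_box (R : realType) (N : nat)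
    (A : 'I_N -> set (measurableTypeR R)) :
  (forall i, measurable (A i)) ->
  lebesgue_tuple R N [set y | forall i, A i (tnth y i)] =
  (\prod_(i < N) lebesgue_measure (A i))%E.
Proof.
elim: N A => [A _|n IH A mA].
  by rewrite big_ord0 /= diracE mem_set// => -[].
rewrite big_ord_recl -IH//.
rewrite -product_measure1E//.
  congr (product_measure1 _ _ _); apply/seteqP; split => -[x y] /=.
    move=> h; split; first exact: (h ord0).
    by move=> i; have := h (lift ord0 i); rewrite tnthS.
  by move=> [h0 h] i; case: (unliftP ord0 i) => [j|] ->; rewrite ?tnthS.
rewrite (_ : mkset _ = \bigcap_i
   ((fun y : n.-tuple (measurableTypeR R) => tnth y i) @^-1` A (lift ord0 i))).
  apply: fin_bigcap_measurable => // i _.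
  by rewrite -[X in measurable X]setTI; exact: measurable_tnth.
by apply/seteqP; split => y /= h i => [_|]; exact: h.
Qed.

Section functions.
Context (R : realType) (N : nat).
Implicit Types h phi : 'rV[R]_N -> \bar R.

Definition proper_fun h :=
  (exists x, h x <> +oo%E) /\ (forall x, h x <> -oo%E).

(* Meant for functions avoiding -oo, for which the right-hand side is never
   of the form +oo - oo; recall that 0 * +oo = 0. *)
Definition convex_efun h :=
  forall (x y : 'rV[R]_N) (t : R), 0 <= t <= 1 ->
    (h (t *: x + (1 - t) *: y)%R <= t%:E * h x + (1 - t)%:E * h y)%E.

Definition inf_compact h :=
  forall a : R, compact [set x | (h x <= a%:E)%E].

(* If the effective domain of phi is Lebesgue-null (equivalently, for a convex
   phi, if it has empty interior), the integral in [cole_hopf] below is 0 and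
   [cole_hopf eps phi ^~ l] is identically +oo, hence not proper, for all l > 0. *)
Definition effective_domain h : set 'rV[R]_N := [set x | (h x < +oo)%E].

(* The norm `|x| of 'rV[R]_N is the sup norm, hence the explicit sum. *)
Definition sqnorm2 (x : 'rV[R]_N) : R := \sum_(i < N) x 0 i ^+ 2.

(* The solution at time l of u_l + |grad u|^2 / 2 = (eps / 2) Laplacian u with
   initial datum phi. The conventions expeR -oo = 0 and lne 0 = -oo account for
   the points where phi = +oo. Only l >= 0 is meaningful. *)
Definition cole_hopf (eps : R) phi (x : 'rV[R]_N) (l : R) : \bar R :=
  if l == 0 then phi x else
  (- (eps%:E *
      lne (((2 * pi * eps * l) `^ (N%:R / 2))^-1%:E *
           \int[lebesgue_tuple R N]_y
             let y' := \row_i tnth y i in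
             expeR (- (eps^-1%:E * phi y')
                    - ((2 * eps * l)^-1 * sqnorm2 (x - y')%R)%:E))))%E.

End functions.

(* Main.v *)
Require Import Defs.
From HB Require Import structures.
From mathcomp Require Import all_boot all_order all_algebra.
From mathcomp Require Import all_classical all_reals all_analysis.
From mathcomp Require Import measurable_realfun ring lra.
Import Order.TTheory GRing.Theory Num.Theory.
Import numFieldNormedType.Exports.
Local Open Scope classical_set_scope.
Local Open Scope ring_scope.

Set Implicit Arguments.
Unset Strict Implicit.
Unset Printing Implicit Defensive.

(** Write k = 1 / (2 eps l), let w(y) = exp(- phi(y) / eps) be the Boltzmann weight of
    phi and I(x) = int w(y) exp(- k |x - y|^2) dy its Gaussian smoothing. For l > 0
    the function u = - eps log(I / Z), Z a positive constant, is a decreasing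
    function of I, and [entropy_level] turns u(x) <= a into
    exp(log Z - a / eps) <= I(x). Each claim on u is thus a claim on the
    superlevel sets of I.

    Convexity of u is log-concavity of I, that is Prékopa's theorem. The joint
    log-concavity of (x, y) |-> w(y) exp(- k |x - y|^2), which follows from the
    convexity of phi and of the squared norm, is the hypothesis of the
    Prékopa-Leindler inequality for the integrands at x1, x2 and
    t x1 + (1 - t) x2 ([log_dominates_boltzmann_gaussian]); its conclusion is the
    log-concavity of I ([smoothing_log_concave]). The inequality itself
    ([prekopa_leindler]) is proved by induction on the dimension with Tonelli's theorem.
    In dimension one the superlevel sets of the three functions satisfy the
    hypothesis of the one-dimensional Brunn-Minkowski inequality
    ([brunn_minkowski1]), and integrating over the levels ([layer_cake]) gives the
    claim after normalizing the suprema.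

    The other claims rest on phi being bounded below, since it is lower semicontinuous
    with compact sublevel sets ([inf_compact_lower_bound]): then w is bounded. Hence
    I is finite, so u > -oo. It is upper semicontinuous by dominated convergence
    ([smoothing_usc]), so u is lower semicontinuous. It vanishes at infinity
    because w does ([smoothing_vanish]), so the sublevel sets of u are bounded.
    Finally w is positive wherever phi is finite, so I > 0 as soon as
    the domain of phi contains a ball ([smoothing_gt0]). *)

(** * The Brunn-Minkowski inequality on the line *)

Section lebesgue_affine.
Context (R : realType).
Notation mu := (@lebesgue_measure R).

(** The preimage is the image t A + s, written so that its measurability is
    that of a composite. Up to the factor t, its measure as a function of A is
    a measure that has the right value on intervals. *)
Lemma lebesgue_measure_affine (t s : R) (A : set (measurableTypeR R)) :
  0 < t -> measurable A ->
  mu ((fun x => (x - s) / t) @^-1` A) = (t%:E * mu A)%E.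
Proof.
move=> t0 mA.
pose f : measurableTypeR R -> measurableTypeR R := fun x => (x - s) / t.
have mf : measurable_fun setT f.
  by apply: measurable_funM => //; apply: measurable_funB.
pose nu := pushforward mu f.
have ti0 : 0 <= t^-1 by rewrite invr_ge0 ltW.
pose m := mscale (NngNum ti0) nu.
suff -> : mu A = m mf A.
  by rewrite /m /mscale/= /nu /pushforward muleA -EFinM divff ?gt_eqF// mul1e.
apply: lebesgue_measure_unique => // _ [[a b] _ <-].
transitivity (t^-1%:E * mu (f @^-1` `]a, b]))%E; last by [].
rewrite (_ : f @^-1` _ = `](t * a + s), (t * b + s)]%classic).
  rewrite !lebesgue_measure_itv/= !lte_fin ltrD2r ltr_pM2l//.
  case: ifPn => _; last by rewrite mule0.
  by rewrite -!EFinD -EFinM; congr EFin; field; rewrite gt_eqF.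
apply/seteqP; split => x /=; rewrite !in_itv/= /f.
  rewrite ltr_pdivlMr// ler_pdivrMr// => /andP[h1 h2]; apply/andP; split; lra.
move=> /andP[h1 h2]; rewrite ltr_pdivlMr// ler_pdivrMr//.
by apply/andP; split; lra.
Qed.

End lebesgue_affine.

Section brunn_minkowski.
Context (R : realType).
Notation mu := (@lebesgue_measure R).
Variables (t : R) (t01 : 0 < t < 1).

(** With a = max K and b = min L, the translates t K + (1 - t) b and
    t a + (1 - t) L lie on either side of t a + (1 - t) b, so they meet in at
    most that point; both are contained in C. *)
Lemma brunn_minkowski1_compact (K L C : set (measurableTypeR R)) :
  compact (K : set R) -> K !=set0 -> compact (L : set R) -> L !=set0 ->
  measurable C ->
  (forall x y, K x -> L y -> C (t * x + (1 - t) * y)) ->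
  (t%:E * mu K + (1 - t)%:E * mu L <= mu C)%E.
Proof.
have /andP[t0 t1] := t01; have s0 : 0 < 1 - t by rewrite subr_gt0.
move=> cK K0 cL L0 mC KLC.
have [a /set_mem Ka amax] : exists2 c, c \in K & forall x, x \in K -> x <= c.
  by apply: (@compact_EVT_max R R id) => //; apply: continuous_subspaceT => x; exact: cvg_id.
have [b /set_mem Lb bmin] : exists2 c, c \in L & forall x, x \in L -> c <= x.
  by apply: (@compact_EVT_min R R id) => //; apply: continuous_subspaceT => x; exact: cvg_id.
have mK : measurable K by exact: compact_measurable.
have mL : measurable L by exact: compact_measurable.
pose K' : set (measurableTypeR R) := (fun x => (x - (1 - t) * b) / t) @^-1` K.
pose L' : set (measurableTypeR R) := (fun x => (x - t * a) / (1 - t)) @^-1` L.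
have mK' : measurable K'.
  rewrite -[K']setTI.
  apply: (_ : measurable_fun setT (fun x : R => (x - (1 - t) * b) / t)) => //.
  by apply: measurable_funM => //; apply: measurable_funB.
have mL' : measurable L'.
  rewrite -[L']setTI.
  apply: (_ : measurable_fun setT (fun x : R => (x - t * a) / (1 - t))) => //.
  by apply: measurable_funM => //; apply: measurable_funB.
have KL' : K' `&` L' `<=` [set t * a + (1 - t) * b].
  move=> x [/mem_set/amax + /mem_set/bmin].
  rewrite ler_pdivrMr// ler_pdivlMr// => h1 h2; apply/eqP; rewrite eq_le.
  by apply/andP; split; lra.
have I0 : mu (K' `&` L') = 0%E.
  apply: (subset_measure0 _ _ KL') => //; first exact: measurableI.
  exact: lebesgue_measure_set1.
have muK' : (mu K' = t%:E * mu K)%E by exact: lebesgue_measure_affine.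
have muL' : (mu L' = (1 - t)%:E * mu L)%E by exact: lebesgue_measure_affine.
have finL' : (mu L' < +oo)%E.
  by rewrite muL' lte_mul_pinfty ?lee_fin ?ltW// compact_finite_measure.
have U : (mu (K' `|` L') = t%:E * mu K + (1 - t)%:E * mu L)%E.
  by rewrite -muK' -muL' measureUfinr//= I0 sube0.
rewrite -U le_measure ?inE//; first exact: measurableU.
move=> x [] /=.
  move=> /KLC/(_ Lb); congr C; field; lra.
move=> /(KLC _ _ Ka); congr C; field; lra.
Qed.

(** Stating the inclusion of t A + (1 - t) B in a measurable set C avoids the question
    whether the sum is measurable. The compact case passes to A and B by
    inner regularity; the points a and b make sure that the compact
    sets are not empty. *)
Lemma brunn_minkowski1 (A B C : set (measurableTypeR R)) :
  measurable A -> A !=set0 -> measurable B -> B !=set0 -> measurable C ->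
  (forall x y, A x -> B y -> C (t * x + (1 - t) * y)) ->
  (t%:E * mu A + (1 - t)%:E * mu B <= mu C)%E.
Proof.
have /andP[t0 t1] := t01; have s0 : 0 < 1 - t by rewrite subr_gt0.
move=> mA [a Aa] mB [b Bb] mC ABC.
have [->|Cfin] := eqVneq (mu C) +oo%E; first by rewrite leey.
have {}Cfin : mu C \is a fin_num by rewrite ge0_fin_numE// ltey.
have KL (K L : set R) : compact K -> K `<=` A -> compact L -> L `<=` B ->
    (t%:E * mu K + (1 - t)%:E * mu L <= mu C)%E.
  move=> cK KA cL LB.
  have cS (x : R) : compact [set x] by exact: compact_set1.
  apply: (@le_trans _ _ (t%:E * mu (K `|` [set a]) + (1 - t)%:E * mu (L `|` [set b]))%E).
    by apply: leeD; rewrite lee_pmul2l// ?lte_fin// le_measure ?inE//;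
      try (apply: compact_measurable; do ?exact: compactU).
  apply: brunn_minkowski1_compact => //.
  - exact: compactU.
  - by exists a; right.
  - exact: compactU.
  - by exists b; right.
  - by move=> x y [/KA Ax|->] [/LB By|->]; exact: ABC.
have muK (K : set R) : compact K -> mu K \is a fin_num.
  by move=> cK; rewrite ge0_fin_numE// compact_finite_measure.
have KB (K : set R) : compact K -> K `<=` A ->
    (t%:E * mu K + (1 - t)%:E * mu B <= mu C)%E.
  move=> cK KA; rewrite addeC -leeBrDr ?fin_numM ?muK// muleC -lee_pdivlMr//.
  rewrite lebesgue_regularity_inner_sup//; apply: ge_ereal_sup => _ [L [cL LB] <-].
  by rewrite lee_pdivlMr// leeBrDr ?fin_numM ?muK// muleC addeC KL.
have muB : mu B \is a fin_num.
  have := KB set0 (@compact0 _) (sub0set A); rewrite measure0 mule0 add0e => h.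
  rewrite ge0_fin_numE// -(@lte_pmul2l _ (1 - t)%:E)// gt0_muley ?lte_fin//.
  by rewrite (le_lt_trans h)// -ge0_fin_numE.
rewrite -leeBrDr ?fin_numM// muleC -lee_pdivlMr//.
rewrite lebesgue_regularity_inner_sup//; apply: ge_ereal_sup => _ [K [cK KA] <-].
by rewrite lee_pdivlMr// leeBrDr ?fin_numM// muleC KB.
Qed.

End brunn_minkowski.

(** * Integrals as integrals over levels *)
Section layer_cake.
Context d (T : measurableType d) (R : realType).
Variable mu : {sigma_finite_measure set T -> \bar R}.
Notation lam := (@lebesgue_measure R).
Local Open Scope ereal_scope.

(** The constraint on s is part of the set, so that integrals over the
    levels in ]0, 1[ become integrals over the whole line. *)
Definition slab (f : T -> \bar R) (M s : R) : set T :=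
  [set x | (0 < s < 1)%R /\ (M * s)%:E < f x].

Let E (f : T -> \bar R) (M : R) : set (T * measurableTypeR R) :=
  [set p | (0 < p.2 < 1)%R /\ (M * p.2)%:E < f p.1].

Let measurableE f M : measurable_fun setT f -> measurable (E f M).
Proof.
move=> mf; rewrite (_ : E f M = (setT `*` `]0%R, 1%R[%classic) `&`
    (setT `&` [set p | (M * p.2)%:E < f p.1])); last first.
  apply/seteqP; split => -[x s] /=; rewrite in_itv/=.
    by move=> [].
  by move=> [[_ ?] [_ ?]].
apply: measurableI; first by apply: measurableX => //; exact: measurable_itv.
apply: measurable_lte => //.
  by apply/measurable_EFinP; apply: measurable_funM.
exact: measurableT_comp.
Qed.

Let slabE f M s : slab f M s = ysection (E f M) s.
Proof. by apply/seteqP; split => x; rewrite /ysection/= inE. Qed.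

Lemma measurable_slab f M s : measurable_fun setT f -> measurable (slab f M s).
Proof. by rewrite slabE => mf; apply: measurable_ysection; exact: measurableE. Qed.

Lemma measurable_mu_slab f M : measurable_fun setT f ->
  measurable_fun setT (fun s : measurableTypeR R => mu (slab f M s)).
Proof.
move=> mf; have := measurable_fun_ysection mu (measurableE M mf).
by congr measurable_fun; apply/funext => s; rewrite slabE.
Qed.

Let length (f : T -> \bar R) M x : (0 < M)%R -> 0 <= f x ->
  M%:E * lam [set s : R | (0 < s < 1)%R /\ (M * s)%:E < f x] = mine (f x) M%:E.
Proof.
move=> M0; case: (f x) => [r|_|//]; last first.
  rewrite (_ : [set s | _] = `]0%R, 1%R[%classic).
    by rewrite lebesgue_measure_itv/= lte01 oppr0 adde0 mule1 minye.
  by apply/seteqP; split => s /=; rewrite in_itv/= ?ltry => // -[].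
rewrite lee_fin => r0.
rewrite (_ : [set s | _] = `]0%R, (Num.min 1 (r / M))%R[%classic); last first.
  apply/seteqP; split => s /=; rewrite in_itv/= lte_fin lt_min.
    by move=> [/andP[-> ->]]; rewrite /= ltr_pdivlMr// mulrC.
  by move=> /and3P[-> ->]; rewrite ltr_pdivlMr// mulrC.
rewrite lebesgue_measure_itv/= lte_fin -EFin_min oppr0 adde0.
have -> : Num.min r M = (M * Num.min 1 (r / M))%R.
  by rewrite minr_pMr ?ltW// mulr1 mulrCA divff ?gt_eqF// mulr1 minC.
case: ifPn; first by rewrite EFinM.
rewrite -leNgt => h; rewrite mule0.
have -> : (Num.min 1 (r / M) = 0)%R; last by rewrite mulr0.
by apply/eqP; rewrite eq_le h le_min ler01 divr_ge0 ?(ltW M0).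
Qed.

(** Both sides are, up to the factor M, the measure of the part of the
    subgraph of f / M below height 1; the truncation is what levels in ]0, 1[ see. *)
Lemma layer_cake f M : (0 < M)%R -> measurable_fun setT f ->
    (forall x, 0 <= f x) ->
  \int[mu]_x mine (f x) M%:E = M%:E * \int[lam]_s mu (slab f M s).
Proof.
move=> M0 mf f0; have mE := measurableE M mf.
have -> : \int[lam]_s mu (slab f M s) = \int[mu]_x lam (xsection (E f M) x).
  have := indic_fubini_tonelli mu lam mE.
  rewrite indic_fubini_tonelli_FE// indic_fubini_tonelli_GE//= => ->.
  by apply: eq_integral => s _; rewrite slabE.
rewrite -ge0_integralZl_EFin ?ltW//; last exact: measurable_fun_xsection.
apply: eq_integral => x _; rewrite -length//; congr (_ * lam _).
by apply/seteqP; split => s; rewrite /xsection/= inE.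
Qed.

End layer_cake.

Section truncation.
Context d (T : measurableType d) (R : realType).
Variable mu : {measure set T -> \bar R}.
Local Open Scope ereal_scope.

Lemma cvg_integral_mine (f : T -> \bar R) : measurable_fun setT f ->
    (forall x, 0 <= f x) ->
  \int[mu]_x mine (f x) n%:R%:E @[n --> \oo] --> \int[mu]_x f x.
Proof.
move=> mf f0.
pose g n x := mine (f x) n%:R%:E.
have -> : \int[mu]_x f x = \int[mu]_x limn (g^~ x).
  apply: eq_integral => x _; apply/esym/cvg_lim => //; rewrite /g.
  move: (f0 x); case: (f x) => [r _|_|//].
    apply: cvg_near_cst; near=> n; apply/min_idPl; rewrite lee_fin.
    by near: n; exact: nbhs_infty_ger.
  under eq_fun do rewrite minye.
  by apply/cvgenyP; exact: cvg_id.
apply: cvg_monotone_convergence => //.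
- by move=> n; exact: measurable_mine.
- by move=> n x _; rewrite le_min f0 lee_fin ler0n.
- move=> x _ m n mn; rewrite /g le_min ge_min lexx/= ge_min.
  by rewrite (_ : m%:R%:E <= n%:R%:E) ?orbT// lee_fin ler_nat.
Unshelve. all: by end_near. Qed.

(** Truncating at M = sup f, or at a large M when the supremum is infinite,
    keeps the integral above c and leaves no level
    M s with s < 1 empty, as the Brunn-Minkowski inequality demands. *)
Lemma level_truncation (f : T -> \bar R) (c : R) : measurable_fun setT f ->
    (forall x, 0 <= f x) -> (0 < c)%R -> c%:E < \int[mu]_x f x ->
  exists2 M, (0 < M)%R & c%:E < \int[mu]_x mine (f x) M%:E /\
    forall s, (s < 1)%R -> exists x, (M * s)%:E < f x.
Proof.
move=> mf f0 c0 cf; pose S := ereal_sup (range f).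
have fS x : f x <= S by apply: ereal_sup_ubound; exists x.
have [S0|S0] := leP S 0.
  move: cf; rewrite integral0_eq ?lte_fin ?ltNge ?ltW// => x _.
  by apply/eqP; rewrite eq_le f0 (le_trans (fS x)).
case ES : S => [M| |]; rewrite ES// in S0 fS.
- rewrite lte_fin in S0; exists M => //; split=> [|s s1].
    rewrite (_ : \int[mu]_x _ = \int[mu]_x f x)//.
    by apply: eq_integral => x _; apply/min_idPl.
  have : (M * s)%:E < S by rewrite ES lte_fin gtr_pMr.
  by move=> /ereal_sup_gt[_ [x _ <-] ?]; exists x.
- suff [n cn] : exists n, c%:E < \int[mu]_x mine (f x) n.+1%:R%:E.
    exists n.+1%:R => //; split => // s _.
    have : (n.+1%:R * s)%:E < S by rewrite ES ltry.
    by move=> /ereal_sup_gt[_ [x _ <-] ?]; exists x.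
  apply: contrapT => /forallNP h.
  have := @cvg_integral_mine _ mf f0; rewrite -(cvg_shiftS) => cv.
  suff : \int[mu]_x f x <= c%:E by rewrite leNgt cf.
  rewrite -(cvg_lim _ cv)//; apply: lime_le; first exact: (cvgP _ cv).
  by apply: nearW => n; rewrite leNgt; apply/negP; exact: h.
Qed.

End truncation.

(** * The Prékopa-Leindler inequality *)

(** The hypothesis h (comb x y) >= f x ^ t * g y ^ (1 - t) of the Prékopa-Leindler
    inequality, stated on strict superlevel sets. This form needs no powers of extended
    reals (hence no convention for 0 * oo), and the conclusion of the
    inequality has the same form for the integrals: this is what lets an
    induction on the dimension feed one integration into the next. *)
Definition log_dominates (R : realType) T (comb : T -> T -> T) (t : R)
    (f g h : T -> \bar R) := forall x y a b,
  ((expR a)%:E < f x)%E -> ((expR b)%:E < g y)%E ->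
  ((expR (t * a + (1 - t) * b))%:E < h (comb x y))%E.

Lemma expR_convex (R : realType) (t a b : R) : 0 <= t <= 1 ->
  expR (t * a + (1 - t) * b) <= t * expR a + (1 - t) * expR b.
Proof.
move=> /andP[t0 t1]; set m := t * a + _.
have ge c : expR m * (1 + (c - m)) <= expR c.
  rewrite (_ : expR c = expR m * expR (c - m)).
    by rewrite ler_wpM2l ?expR_ge0// expR_ge1Dx.
  by rewrite -expRD addrC subrK.
have := ler_wpM2l t0 (ge a); have := ler_wpM2l (_ : 0 <= 1 - t) (ge b).
rewrite subr_ge0 => /(_ t1) hb ha.
apply: le_trans (lerD ha hb); rewrite le_eqVlt; apply/orP; left; apply/eqP.
by rewrite {3 5}/m; ring.
Qed.

Section prekopa_leindler.
Context (R : realType) (t : R) (t01 : 0 < t < 1).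
Notation mu := (@lebesgue_measure R).

Let t0 : 0 < t. Proof. by case/andP : t01. Qed.
Let s0 : 0 < 1 - t. Proof. by case/andP : t01; rewrite subr_gt0. Qed.

(** With e^al and e^be the truncation levels of f and g, and
    ga = t al + (1 - t) be, the level e^ga s of h contains the combination of the
    levels e^al s of f and e^be s of g, because s = s^t s^(1 - t). Brunn-Minkowski
    and integration over s in ]0, 1[ give
    e^(- ga) int h >= t e^(- al) int f + (1 - t) e^(- be) int g, and convexity
    of exp compares the right-hand side with the geometric mean. *)
Lemma prekopa_leindler1 (f g h : measurableTypeR R -> \bar R) (a b : R) :
  measurable_fun setT f -> (forall x, 0 <= f x)%E ->
  measurable_fun setT g -> (forall x, 0 <= g x)%E ->
  measurable_fun setT h -> (forall x, 0 <= h x)%E ->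
  log_dominates (fun x y : R => t * x + (1 - t) * y) t f g h ->
  ((expR a)%:E < \int[mu]_x f x)%E -> ((expR b)%:E < \int[mu]_x g x)%E ->
  ((expR (t * a + (1 - t) * b))%:E < \int[mu]_x h x)%E.
Proof.
move=> mf f0 mg g0 mh h0 fgh af bg.
(* al and be are the logarithms of the truncation levels of f and g. *)
have [_ /expR_total[al <-] [afm flev]] := level_truncation mf f0 (expR_gt0 a) af.
have [_ /expR_total[be <-] [bgm glev]] := level_truncation mg g0 (expR_gt0 b) bg.
rewrite layer_cake ?expR_gt0// in afm; rewrite layer_cake ?expR_gt0// in bgm.
pose ga := t * al + (1 - t) * be.
have hm : ((expR ga)%:E * \int[mu]_s mu (slab h (expR ga) s) <= \int[mu]_x h x)%E.
  rewrite -layer_cake ?expR_gt0//; apply: ge0_le_integral => //.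
  - by move=> x _; rewrite le_min h0 lee_fin expR_ge0.
  - exact: measurable_mine.
  - by move=> x _; rewrite ge_min lexx.
apply: lt_le_trans hm.
have lev s : (t%:E * mu (slab f (expR al) s) + (1 - t)%:E * mu (slab g (expR be) s)
    <= mu (slab h (expR ga) s))%E.
  have [s01|s01] := boolP (0 < s < 1); last first.
    have sl0 k M : slab k M s = set0 :> set (measurableTypeR R).
      by apply/seteqP; split => // x [] /(negP s01).
    by rewrite !sl0 !measure0 !mule0 adde0.
  have /andP[sgt0 slt1] := s01.
  have [x0 fx0] := flev s slt1; have [y0 gy0] := glev s slt1.
  apply: brunn_minkowski1 => //.
  - exact: measurable_slab.
  - by exists x0; split.
  - exact: measurable_slab.
  - by exists y0; split.
  - exact: measurable_slab.
  (* On logarithms the levels are al + si, be + si and ga + si. *)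
  have [si si_s] := expR_total sgt0; rewrite -si_s.
  move=> x y [_ fx] [_ gy]; split => //; rewrite si_s// -si_s.
  move: fx gy; rewrite -!expRD => fx gy.
  have := fgh _ _ _ _ fx gy; congr (_%:E < _)%E; congr expR; rewrite /ga; ring.
have intlev : (t%:E * \int[mu]_s mu (slab f (expR al) s)
    + (1 - t)%:E * \int[mu]_s mu (slab g (expR be) s)
    <= \int[mu]_s mu (slab h (expR ga) s))%E.
  rewrite -!ge0_integralZl_EFin ?(ltW t0) ?(ltW s0)//; try exact: measurable_mu_slab.
  rewrite -ge0_integralD//; last 4 first.
  - by move=> s _; rewrite mule_ge0// lee_fin ltW.
  - by apply: emeasurable_funM => //; exact: measurable_mu_slab.
  - by move=> s _; rewrite mule_ge0// lee_fin ltW.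
  - by apply: emeasurable_funM => //; exact: measurable_mu_slab.
  apply: ge0_le_integral => //.
  - by move=> s _; rewrite adde_ge0// mule_ge0// lee_fin ltW.
  - by apply: emeasurable_funD; apply: emeasurable_funM => //; exact: measurable_mu_slab.
  - exact: measurable_mu_slab.
apply: lt_le_trans (lee_wpmul2l _ intlev); last by rewrite lee_fin expR_ge0.
(* Dividing by the truncation levels normalizes f and g to supremum 1. *)
have norm k M c : ((expR c)%:E < (expR M)%:E * \int[mu]_s mu (slab k (expR M) s) ->
   (expR (c - M))%:E < \int[mu]_s mu (slab k (expR M) s))%E.
  by rewrite -lte_pdivrMl ?expR_gt0// -EFinM -expRN -expRD addrC.
have := norm _ _ _ afm; have := norm _ _ _ bgm => {norm} nb na.
apply: (@le_lt_trans _ _ ((expR ga)%:E *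
   (t%:E * (expR (a - al))%:E + (1 - t)%:E * (expR (b - be))%:E))%E).
  rewrite -!EFinM lee_fin.
  have -> : t * a + (1 - t) * b = ga + (t * (a - al) + (1 - t) * (b - be)).
    by rewrite /ga; ring.
  rewrite [leLHS]expRD; apply: ler_wpM2l (expR_ge0 _) _ _ _; apply: expR_convex.
  by case/andP: t01 => ? ?; rewrite !ltW.
rewrite lte_pmul2l ?lte_fin ?expR_gt0//.
by apply: lteD; rewrite lte_pmul2l ?lte_fin.
Qed.

End prekopa_leindler.

(** * Induction on the dimension *)
Section lebesgue_tuple_integral.
Context (R : realType) (n : nat).
Notation lam := (@lebesgue_measure R).
Local Open Scope ereal_scope.
Variable f : n.+1.-tuple (measurableTypeR R) -> \bar R.
Hypothesis (mf : measurable_fun setT f) (f0 : forall y, 0 <= f y).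

Let mfc : measurable_fun setT
  (f \o @cons_pair _ (measurableTypeR R) n).
Proof. by apply: measurableT_comp => //; exact: measurable_cons_pair. Qed.

Lemma measurable_cons_slice (x : measurableTypeR R) :
  measurable_fun setT (fun y : n.-tuple (measurableTypeR R) => f (cons_pair (x, y))).
Proof. by apply: (measurableT_comp mfc); exact: pair1_measurable. Qed.

Lemma measurable_integral_cons : measurable_fun setT
  (fun x : measurableTypeR R => \int[lebesgue_tuple R n]_y f (cons_pair (x, y))).
Proof.
apply: (measurable_fun_fubini_tonelli_F (m2 := lebesgue_tuple R n)
  (f \o @cons_pair _ (measurableTypeR R) n)) => // p.
exact: f0.
Qed.

Lemma integral_lebesgue_tupleS : \int[lebesgue_tuple R n.+1]_y f y =
  \int[lam]_x \int[lebesgue_tuple R n]_y f (cons_pair (x, y)).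
Proof.
rewrite [LHS](_ : _ =
  \int[pushforward (lam \x lebesgue_tuple R n) (@cons_pair _ _ n)]_y f y)//.
rewrite ge0_integral_pushforward//=; last exact: measurable_cons_pair.
by rewrite preimage_setT fubini_tonelli1// => p; exact: f0.
Qed.

End lebesgue_tuple_integral.

Definition tuple_conv (R : realType) N (t : R)
    (x y : N.-tuple (measurableTypeR R)) : N.-tuple (measurableTypeR R) :=
  [tuple t * tnth x i + (1 - t) * tnth y i | i < N].

(** For fixed first coordinates the slices of f, g and h satisfy the hypothesis
    in dimension n, so their integrals satisfy it on the line. *)
Lemma prekopa_leindler (R : realType) (t : R) (t01 : 0 < t < 1) N
    (f g h : N.-tuple (measurableTypeR R) -> \bar R) (a b : R) :
  measurable_fun setT f -> (forall x, 0 <= f x)%E ->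
  measurable_fun setT g -> (forall x, 0 <= g x)%E ->
  measurable_fun setT h -> (forall x, 0 <= h x)%E ->
  log_dominates (tuple_conv t) t f g h ->
  ((expR a)%:E < \int[lebesgue_tuple R N]_x f x)%E ->
  ((expR b)%:E < \int[lebesgue_tuple R N]_x g x)%E ->
  ((expR (t * a + (1 - t) * b))%:E < \int[lebesgue_tuple R N]_x h x)%E.
Proof.
elim: N f g h a b => [|n IH] f g h a b mf f0 mg g0 mh h0 fgh.
  rewrite !integral_dirac// !diracT !mul1e => fa gb.
  by have := fgh _ _ _ _ fa gb; rewrite (tuple0 (tuple_conv _ _ _)).
rewrite !integral_lebesgue_tupleS//.
apply: prekopa_leindler1 => //; try (exact: measurable_integral_cons);
  try by move=> x; exact: integral_ge0.
move=> x y a' b'; apply: IH; try exact: measurable_cons_slice; try by [].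
move=> x' y' c d fc gd.
have := fgh _ _ _ _ fc gd; congr (_ < h _)%E.
apply: eq_from_tnth => i; rewrite tnth_mktuple.
by case: (unliftP ord0 i) => [j|] ->; rewrite ?tnthS ?tnth0//= tnth_mktuple.
Qed.

(** * Measurability of lower semicontinuous functions *)
Section row_of_tuple.
Context (R : realType) (N : nat).
Notation tupR := (N.-tuple (measurableTypeR R)).

Definition row_of_tuple (y : tupR) : 'rV[R]_N := \row_i tnth y i.

Let measurable_box (x : 'rV[R]_N) (e : R) :
  measurable [set y : tupR | forall i, `|x ord0 i - tnth y i| < e].
Proof.
rewrite (_ : [set _ | _] =
  \bigcap_(i in setT) ((fun y : tupR => tnth y i) @^-1` ball (x ord0 i) e)).
  apply: fin_bigcap_measurable => // i _.
  rewrite -[X in measurable X]setTI; apply: measurable_tnth => //.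
  exact: measurable_ball.
by apply/seteqP; split => y /= h i => [_|]; exact: h.
Qed.

(** The sigma-algebra on tuples is generated by the coordinates, while the
    topology is that of the sup norm: an open set is the countable union of the
    cubes with rational center and radius 1 / (k + 1) that it contains. *)
Lemma measurable_row_of_tuple_open (U : set 'rV[R]_N) : open U ->
  measurable (row_of_tuple @^-1` U).
Proof.
move=> oU.
pose B (p : N.-tuple rat * nat) : set tupR :=
  [set y | (forall z : 'rV[R]_N,
      (forall i, `|ratr (tnth p.1 i) - z ord0 i| < p.2.+1%:R^-1) -> U z) /\
    forall i, `|(\row_i ratr (tnth p.1 i)) ord0 i - tnth y i| < p.2.+1%:R^-1].
rewrite (_ : _ @^-1` _ = \bigcup_p B p).
  apply: countable_bigcupT_measurable => [|p]; first exact: countableP.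
  have [Up|Up] := pselect (forall z : 'rV[R]_N,
    (forall i, `|ratr (tnth p.1 i) - z ord0 i| < p.2.+1%:R^-1) -> U z).
    rewrite (_ : B p = [set y | forall i,
      `|(\row_i ratr (tnth p.1 i)) ord0 i - tnth y i| < p.2.+1%:R^-1]) //.
    by apply/seteqP; split => y /= => [[]|].
  by rewrite (_ : B p = set0) //; apply/seteqP; split => // y [].
apply/seteqP; split => [y /= Uy|y [[q k] _ [/= h1 h2]]]; last first.
  by apply: h1 => i; have := h2 i; rewrite !mxE.
have [e /= e0 eU] : exists2 e : R, 0 < e & ball (row_of_tuple y) e `<=` U.
  have /nbhs_ballP[e e0 eU] : nbhs (row_of_tuple y) U by exact: open_nbhs_nbhs.
  by exists e.
(* Radius below e / 2, so that a cube containing y stays within e of y. *)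
have [k ke] : exists k, 0 + k.+1%:R^-1 < e / 2 by apply: ltr_add_invr; lra.
rewrite add0r in ke.
have k0 : 0 < k.+1%:R^-1 :> R by [].
have hq i : exists q : rat, `|ratr q - tnth y i| < k.+1%:R^-1.
  have /rat_in_itvoo[q] : (tnth y i : R) - k.+1%:R^-1 < tnth y i + k.+1%:R^-1.
    by rewrite ltrD2l gtrN.
  by rewrite in_itv/= => qy; exists q; rewrite ltr_distl.
have {hq} [q hq] := choice hq.
exists ([tuple q i | i < N], k) => //; split => [z /= hz|i /=]; last first.
  by rewrite mxE tnth_mktuple.
apply: eU; split => // i j; rewrite ord1 mxE /ball/=.
have := hq j; have := hz j; rewrite tnth_mktuple.
move: (ratr _) => r h1 h2.
rewrite (le_lt_trans (ler_distD r _ _))// (distrC _ r) (splitr e).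
by rewrite ltrD// (lt_trans _ ke).
Qed.

Lemma measurable_lsc_row_of_tuple (f : 'rV[R]_N -> \bar R) :
  lower_semicontinuous f -> measurable_fun setT (f \o row_of_tuple).
Proof.
move=> scif; apply: (measurability _ (ErealGenOInfty.measurableE R)).
move=> /= _ [_ [a ->]] <-; apply: measurableI => //.
rewrite preimage_itvoy.
apply: (@measurable_row_of_tuple_open [set x | (a%:E < f x)%E]).
by move/lower_semicontinuousP : scif; exact.
Qed.

End row_of_tuple.

(** * Gaussian integrals *)
Section gaussian.
Context (R : realType).
Notation lam := (@lebesgue_measure R).

Definition gaussian N (k : R) (x : 'rV[R]_N) (y : N.-tuple (measurableTypeR R)) : R :=
  expR (- (k * sqnorm2 (x - row_of_tuple y))).

Lemma measurable_sqnorm2_row N (x : 'rV[R]_N) :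
  measurable_fun setT (fun y : N.-tuple (measurableTypeR R) => sqnorm2 (x - row_of_tuple y)).
Proof.
rewrite /sqnorm2; apply: measurable_sum => i.
apply: measurable_funX; under eq_fun do rewrite !mxE.
by apply: measurable_funB => //; exact: measurable_tnth.
Qed.

Lemma measurable_gaussian N k x : measurable_fun setT (@gaussian N k x).
Proof.
apply: measurableT_comp => //; apply: measurableT_comp => //.
by apply: measurable_funM => //; exact: measurable_sqnorm2_row.
Qed.

Let integral_gaussian1 (k : R) : 0 < k ->
  exists Z : R, forall c : R, (\int[lam]_x (expR (- (k * (c - x) ^+ 2)))%:E = Z%:E)%E.
Proof.
move=> k0.
(* The variance s^2 = 1 / (2 k) makes the integrand a multiple of a normal density. *)
pose s : R := Num.sqrt (2 * k)^-1.
have k20 : 0 < (2 * k)^-1 by rewrite invr_gt0 mulr_gt0.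
have s0 : s != 0 by rewrite gt_eqF// sqrtr_gt0.
exists (normal_peak s)^-1 => c.
have pe x : (expR (- (k * (c - x) ^+ 2)) = (normal_peak s)^-1 * normal_pdf c s x)%R.
  rewrite normal_pdfE// mulrA mulVf ?mul1r ?gt_eqF ?normal_peak_gt0//.
  congr expR; rewrite sqr_sqrtr ?(ltW k20)//; field; by rewrite gt_eqF.
under eq_integral do rewrite pe EFinM.
rewrite ge0_integralZl_EFin//.
- by rewrite integral_normal_pdf mule1.
- by move=> x _; rewrite lee_fin normal_pdf_ge0.
- by apply/measurable_EFinP; exact: measurable_normal_pdf.
- by rewrite invr_ge0 normal_peak_ge0.
Qed.

(** That the value does not depend on the center is what makes the bounds
    on smoothings below uniform in x. *)
Lemma integral_gaussian N (k : R) : 0 < k -> exists C : R, forall x : 'rV[R]_N,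
  (\int[lebesgue_tuple R N]_y (gaussian k x y)%:E = C%:E)%E.
Proof.
move=> k0; elim: N => [|n [C IH]].
  exists 1 => x; rewrite integral_dirac//; last first.
    by apply/measurable_EFinP; exact: measurable_gaussian.
  by rewrite diracT mul1e /gaussian /sqnorm2 big_ord0 mulr0 oppr0 expR0.
have [Z Zi] := integral_gaussian1 k0.
exists (Z * C) => x; rewrite integral_lebesgue_tupleS; last 2 first.
- by apply/measurable_EFinP; exact: measurable_gaussian.
- by move=> y; rewrite lee_fin expR_ge0.
pose x' : 'rV[R]_n := \row_i x ord0 (lift ord0 i).
have split_g r y : gaussian k x (cons_pair (r, y)) =
    expR (- (k * (x ord0 ord0 - r) ^+ 2)) * gaussian k x' y.
  rewrite /gaussian -expRD; congr expR; rewrite /sqnorm2 big_ord_recl.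
  rewrite mulrDr opprD !mxE; congr (- (_ * (_ - _) ^+ 2) - _ * _).
  by apply: eq_bigr => i _; rewrite !mxE tnthS.
transitivity (\int[lam]_r ((expR (- (k * (x ord0 ord0 - r) ^+ 2)))%:E * C%:E))%E.
  apply: eq_integral => r _ /=.
  under eq_integral do rewrite split_g EFinM.
  rewrite ge0_integralZl_EFin ?expR_ge0//; first by rewrite IH.
    by move=> y _; rewrite lee_fin expR_ge0.
  by apply/measurable_EFinP; exact: measurable_gaussian.
under eq_integral do rewrite muleC.
have C0 : 0 <= C.
  by rewrite -lee_fin -(IH 0); apply: integral_ge0 => y _; rewrite lee_fin expR_ge0.
rewrite ge0_integralZl_EFin//; last first.
  apply/measurable_EFinP; apply: measurableT_comp => //; apply: measurableT_comp => //.
  by apply: measurable_funM => //; apply: measurable_funX; exact: measurable_funB.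
by rewrite Zi -EFinM mulrC.
Qed.

End gaussian.

(** * The squared Euclidean norm *)
Section sqnorm2_theory.
Context (R : realType) (N : nat).
Implicit Types x y : 'rV[R]_N.

Lemma sqnorm2_ge0 x : 0 <= sqnorm2 x.
Proof. by apply: sumr_ge0 => i _; rewrite sqr_ge0. Qed.

Lemma normr_coord_le x i : `|x ord0 i| <= `|x|.
Proof.
rewrite [leRHS]/Num.norm/= mx_normrE.
by apply: (le_trans _ (le_bigmax _ (fun p : 'I_1 * 'I_N => `|x p.1 p.2|) (ord0, i))).
Qed.

Lemma sqr_normr_le_sqnorm2 x : `|x| ^+ 2 <= sqnorm2 x.
Proof.
rewrite [`|x|]/Num.norm/=.
have [->|/mx_norm_neq0[p ->]] := eqVneq (mx_norm x) 0.
  by rewrite expr0n sqnorm2_ge0.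
rewrite real_normK ?num_real// /sqnorm2 (bigD1 p.2)//= (ord1 p.1) lerDl.
by apply: sumr_ge0 => i _; rewrite sqr_ge0.
Qed.

Lemma sqnorm2_le x : sqnorm2 x <= N%:R * `|x| ^+ 2.
Proof.
rewrite /sqnorm2 (@le_trans _ _ (\sum_(i < N) `|x| ^+ 2))//.
  apply: ler_sum => i _; rewrite -(real_normK (num_real (x _ _))).
  by rewrite lerXn2r ?nnegrE// normr_coord_le.
by rewrite sumr_const card_ord mulr_natl.
Qed.

(** Coordinatewise this is (a + 2 b)^2 >= 0. It moves the center of a Gaussian at the cost
    of halving its exponent. *)
Lemma half_sqnorm2_le x y : sqnorm2 x / 2 - sqnorm2 y <= sqnorm2 (x + y).
Proof.
rewrite /sqnorm2 mulr_suml -sumrB; apply: ler_sum => i _; rewrite !mxE.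
have := sqr_ge0 (x 0 i + 2 * y 0 i); nra.
Qed.

Lemma sqnorm2_convex t x y : 0 <= t <= 1 ->
  sqnorm2 (t *: x + (1 - t) *: y) <= t * sqnorm2 x + (1 - t) * sqnorm2 y.
Proof.
move=> /andP[t0 t1]; rewrite /sqnorm2 !mulr_sumr -big_split/=.
apply: ler_sum => i _; rewrite !mxE -subr_ge0.
rewrite [leRHS](_ : _ = t * (1 - t) * (x 0 i - y 0 i) ^+ 2); last by ring.
by rewrite mulr_ge0 ?sqr_ge0// mulr_ge0// subr_ge0.
Qed.

Lemma sqnorm2_continuous : continuous (@sqnorm2 R N).
Proof.
move=> x; apply: (@cvg_big R _ +%R 0 predT (@add_continuous R) _ (nbhs x)
  (index_enum 'I_N) (fun i z => z 0 i ^+ 2) (fun i => x 0 i ^+ 2)) => i _.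
apply: (@continuous_comp _ _ _ (fun z : 'rV[R]_N => z 0 i) (fun r : R => r ^+ 2)).
  exact: coord_continuous.
exact: exprn_continuous.
Qed.

End sqnorm2_theory.

(** * Gaussian smoothing of a bounded weight *)
Section gaussian_smoothing.
Context (R : realType) (N : nat).
Notation tupR := (N.-tuple (measurableTypeR R)).
Notation leb := (lebesgue_tuple R N).
Variables (k : R) (k0 : 0 < k) (w : tupR -> R) (B : R).
Hypotheses (mw : measurable_fun setT w) (w0 : forall y, 0 <= w y)
  (wB : forall y, w y <= B).

Definition smoothing (x : 'rV[R]_N) : \bar R :=
  (\int[leb]_y (w y * gaussian k x y)%:E)%E.

Let B0 : 0 <= B.
Proof. exact: le_trans (w0 [tuple 0 | i < N]) (wB _). Qed.

Let k20 : 0 < k / 2. Proof. by rewrite divr_gt0. Qed.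

Let gauss0 c x (y : tupR) : 0 <= gaussian c x y. Proof. exact: expR_ge0. Qed.

Let mwg x : measurable_fun setT (fun y => (w y * gaussian k x y)%:E : \bar R).
Proof.
by apply/measurable_EFinP; apply: measurable_funM => //; exact: measurable_gaussian.
Qed.

Lemma smoothing_ge0 x : (0 <= smoothing x)%E.
Proof. by apply: integral_ge0 => y _; rewrite lee_fin mulr_ge0. Qed.

Lemma smoothing_fin_num x : smoothing x \is a fin_num.
Proof.
rewrite ge0_fin_numE ?smoothing_ge0//.
have [C gC] := @integral_gaussian R N k k0.
apply: (@le_lt_trans _ _ (\int[leb]_y (B%:E * (gaussian k x y)%:E))%E).
  apply: ge0_le_integral => //.
  - by move=> y _; rewrite lee_fin mulr_ge0.
  - by apply/measurable_EFinP; apply: measurable_funM => //; exact: measurable_gaussian.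
  - by move=> y _; rewrite lee_fin ler_wpM2r.
rewrite ge0_integralZl_EFin//; first by rewrite gC ltry.
  by move=> y _; rewrite lee_fin.
by apply/measurable_EFinP; exact: measurable_gaussian.
Qed.

(** One integrable function dominates the Gaussians at all centers within
    distance 1 of x0. *)
Let gaussian_shift_le (x0 x : 'rV[R]_N) y : `|x - x0| <= 1 ->
  gaussian k x y <= expR (k * N%:R) * gaussian (k / 2) x0 y.
Proof.
move=> xx0; rewrite /gaussian -expRD ler_expR.
have := half_sqnorm2_le (x0 - row_of_tuple y) (x - x0).
rewrite (addrC (x0 - _)) addrA subrK => h.
have qN : sqnorm2 (x - x0) <= N%:R.
  by rewrite (le_trans (sqnorm2_le _))// ler_piMr// expr_le1.
move: (sqnorm2 (x - row_of_tuple y)) (sqnorm2 (x0 - row_of_tuple y)) h qN => q q0.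
move: (sqnorm2 _) (N%:R : R) => q1 n h qN.
have : 0 <= k * (q - (q0 / 2 - n)) by rewrite mulr_ge0 ?(ltW k0)//; lra.
by lra.
Qed.

(** Otherwise some sequence converging to x0 keeps the smoothing above a, and
    dominated convergence contradicts the strict inequality at x0. *)
Lemma smoothing_usc x0 (a : R) : (smoothing x0 < a%:E)%E ->
  \forall x \near x0, (smoothing x < a%:E)%E.
Proof.
move=> xa; apply: contrapT => nnear.
have ex n : exists x, `|x - x0| < n.+1%:R^-1 /\ (a%:E <= smoothing x)%E.
  apply: contrapT => h; apply: nnear; apply/nbhs_ballP; exists n.+1%:R^-1 => //=.
  move=> x; rewrite -ball_normE/= distrC => xx0.
  by rewrite ltNge; apply/negP => ax; apply: h; exists x.
have [u /all_and2 [ux0 au]] := choice ex.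
have ucv : u n @[n --> \oo] --> x0.
  apply/cvgrPdist_lt => e e0; near=> n; rewrite distrC (lt_trans (ux0 _))//.
  by near: n; exact: near_infty_natSinv_lt (PosNum e0).
have [C gC] := @integral_gaussian R N (k / 2) k20.
pose G y := ((B * expR (k * N%:R))%:E * (gaussian (k / 2) x0 y)%:E)%E.
have mg c x : measurable_fun setT (fun y : tupR => (gaussian c x y)%:E).
  by apply/measurable_EFinP; exact: measurable_gaussian.
have iG : leb.-integrable setT G.
  apply: integrableZl => //; apply/integrableP; split => //.
  under eq_integral do rewrite gee0_abs ?lee_fin//.
  by rewrite gC ltry.
have aecv : {ae leb, forall y : tupR, setT y ->
    (w y * gaussian k (u n) y)%:E @[n --> \oo] --> (w y * gaussian k x0 y)%:E}.
  apply: aeW => y _; apply/cvg_EFin; first by apply: nearW.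
  apply: cvgM; first exact: cvg_cst.
  apply: (cvg_comp (fun n => - (k * sqnorm2 (u n - row_of_tuple y))) expR);
    last exact: continuous_expR.
  apply: (@cvgN _ R^o); apply: cvgM; first exact: cvg_cst.
  apply: (cvg_comp (fun n => u n - row_of_tuple y) (@sqnorm2 R N));
    last exact: sqnorm2_continuous.
  by apply: cvgB => //; exact: cvg_cst.
have aele : {ae leb, forall y n, setT y -> (`|(w y * gaussian k (u n) y)%:E| <= G y)%E}.
  apply: aeW => y n _; rewrite gee0_abs ?lee_fin ?mulr_ge0//.
  rewrite -mulrA; apply: ler_pM => //; apply: gaussian_shift_le.
  by rewrite (le_trans (ltW (ux0 n)))// invf_le1// ler1n.
have [_ _ cv] := dominated_convergence measurableT (fun n => mwg (u n)) (mwg x0)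
  aecv iG aele.
have : (a%:E <= smoothing x0)%E.
  by apply: (cvge_ge _ cv); apply: nearW => n; exact: au.
by rewrite leNgt xa.
Unshelve. all: by end_near. Qed.

(** Where w is at most d the integrand is at most d times a Gaussian; elsewhere y
    stays in the ball of radius r, at distance at least |x| - r from x, and half of the
    Gaussian exponent supplies a factor exp(- k (|x| - r) / 2). *)
Lemma smoothing_vanish (e : R) : 0 < e ->
    (forall d : R, 0 < d -> exists r, forall y, d < w y -> `|row_of_tuple y| <= r) ->
  exists r, forall x, r < `|x| -> (smoothing x < e%:E)%E.
Proof.
move=> e0 wd.
have [C gC] := @integral_gaussian R N k k0.
have [C' gC'] := @integral_gaussian R N (k / 2) k20.
have C0 : 0 <= C.
  by rewrite -lee_fin -(gC 0); apply: integral_ge0 => y _; rewrite lee_fin.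
have C'0 : 0 <= C'.
  by rewrite -lee_fin -(gC' 0); apply: integral_ge0 => y _; rewrite lee_fin.
pose d := e / (2 * (C + 1)).
have d0 : 0 < d by rewrite divr_gt0// mulr_gt0// ltr_wpDl.
have [r rw] := wd d d0.
(* This s makes B * C' * exp(- k s / 2) smaller than e / 2, by exp u >= 1 + u;
   s >= 1 gives s <= s ^ 2. *)
pose s := 1 + 4 * B * C' / (e * k).
have s1 : 1 <= s by rewrite lerDl divr_ge0 ?mulr_ge0// ltW.
exists (r + s) => x rsx.
pose D := B * expR (- (k / 2 * s)).
have D0 : 0 <= D by rewrite mulr_ge0 ?expR_ge0.
have bound y : w y * gaussian k x y <= d * gaussian k x y + D * gaussian (k / 2) x y.
  have [wyd|/rw yr] := leP (w y) d.
    by rewrite ler_wpDr ?mulr_ge0// ler_wpM2r.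
  apply: (@le_trans _ _ (D * gaussian (k / 2) x y)); last first.
    by rewrite lerDr mulr_ge0// ltW.
  rewrite /D -mulrA; apply: ler_pM => //.
  rewrite /gaussian -expRD ler_expR.
  have sx : s <= `|x - row_of_tuple y|.
    by have := lerB_dist x (row_of_tuple y); lra.
  have := sqr_normr_le_sqnorm2 (x - row_of_tuple y).
  move: (sqnorm2 _) `|x - _| sx => q v sv vq.
  have sq : s <= q by apply: le_trans vq; nra.
  have : 0 <= k / 2 * (q - s) by rewrite mulr_ge0 ?subr_ge0// ltW.
  by lra.
apply: (@le_lt_trans _ _ (d * C + D * C')%:E).
  rewrite EFinD !EFinM -(gC x) -(gC' x).
  have mg c z : measurable_fun setT (fun y : tupR => (gaussian c z y)%:E : \bar R).
    by apply/measurable_EFinP; exact: measurable_gaussian.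
  rewrite -!ge0_integralZl_EFin ?(ltW d0)//; try by move=> y _; rewrite lee_fin.
  rewrite -ge0_integralD//; last 4 first.
  - by move=> y _; rewrite -EFinM lee_fin mulr_ge0 ?(ltW d0).
  - by apply: emeasurable_funM.
  - by move=> y _; rewrite -EFinM lee_fin mulr_ge0.
  - by apply: emeasurable_funM.
  apply: ge0_le_integral => //.
  - by move=> y _; rewrite lee_fin mulr_ge0.
  - by apply: emeasurable_funD; apply: emeasurable_funM.
  - by move=> y _; rewrite -!EFinM -EFinD lee_fin.
rewrite lte_fin.
have dC : d * C <= e / 2.
  rewrite /d mulrAC ler_pdivrMr ?mulr_gt0 ?ltr_wpDl//.
  by rewrite mulrA divfK// ler_wpM2l ?(ltW e0)// lerDl.
have DC : D * C' < e / 2.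
  rewrite /D expRN mulrAC ltr_pdivrMr ?expR_gt0//.
  apply: lt_le_trans (ler_wpM2l _ (expR_ge1Dx _)); last by rewrite divr_ge0 ?ltW.
  have -> : e / 2 * (1 + k / 2 * s) = e / 2 + e * k / 4 + B * C'.
    by rewrite /s; field; rewrite !gt_eqF.
  by rewrite ltrDr addr_gt0 ?divr_gt0 ?mulr_gt0.
by rewrite (splitr e) ler_ltD.
Qed.

End gaussian_smoothing.

(** A null integral would make the positive integrand vanish almost everywhere
    on a cube, which has positive measure. *)
Lemma smoothing_gt0 (R : realType) N (k : R) (w : N.-tuple (measurableTypeR R) -> R)
    (c x : 'rV[R]_N) (r : R) :
  measurable_fun setT w -> (forall y, 0 <= w y) -> 0 < r ->
  (forall y, `|row_of_tuple y - c| < r -> 0 < w y) ->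
  (0 < smoothing k w x)%E.
Proof.
move=> mw w0 r0 wc; pose f y := ((w y * gaussian k x y)%:E : \bar R).
have f0 y : (0 <= f y)%E by rewrite lee_fin mulr_ge0 ?expR_ge0.
have mf : measurable_fun setT f.
  by apply/measurable_EFinP; apply: measurable_funM => //; exact: measurable_gaussian.
rewrite lt_neqAle smoothing_ge0// andbT eq_sym; apply/eqP => If0.
have : ae_eq (lebesgue_tuple R N) setT f (cst 0%E).
  apply/ae_eq_integral_abs => //; under eq_integral do rewrite gee0_abs//.
  exact: If0.
move=> [A [mA A0 fA]].
pose box := [set y : N.-tuple (measurableTypeR R) |
  forall i, ball (c ord0 i) r (tnth y i)].
have mbox : measurable box.
  rewrite (_ : box = @row_of_tuple R N @^-1` ball c r).
    by apply: measurable_row_of_tuple_open; exact: ball_open.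
  apply/seteqP; split => y /= h; first by split => // i j; rewrite ord1 mxE.
  by move=> i; have := h.2 ord0 i; rewrite mxE.
have boxA : box `<=` A.
  move=> y hy; apply: fA => /= /(_ Logic.I) /eqP.
  rewrite eqe mulf_eq0 (gt_eqF (expR_gt0 _)) orbF gt_eqF//; apply: wc.
  have : ball c r (row_of_tuple y) by split => // i j; rewrite ord1 mxE.
  by rewrite -ball_normE/= distrC.
have : (0 < lebesgue_tuple R N box)%E.
  have -> : lebesgue_tuple R N box = (\prod_(i < N) lebesgue_measure (ball (c ord0 i) r))%E.
    apply: (@lebesgue_tuple_box R N (fun i => ball (c ord0 i) r)) => i.
    exact: measurable_ball.
  apply: (big_ind (fun p => 0 < p)%E) => [|p q|i _]; [exact: lte01|exact: mule_gt0|].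
  by rewrite lebesgue_measure_ball ?ltW// lte_fin mulrn_wgt0.
by rewrite (subset_measure0 mbox mA boxA A0) ltxx.
Qed.

(** The open sets where phi > - n cover the compact sublevel set at 0. *)
Lemma inf_compact_lower_bound (R : realType) N (phi : 'rV[R]_N -> \bar R) :
  (forall x, phi x <> -oo%E) -> lower_semicontinuous phi -> inf_compact phi ->
  exists m : R, forall x, (m%:E <= phi x)%E.
Proof.
move=> phiNy /lower_semicontinuousP lsc /(_ 0); rewrite compact_cover => cK.
have [||D _ KD] := cK nat setT (fun n => [set x | ((- n%:R)%:E < phi x)%E]).
- by move=> n _; exact: lsc.
- move=> x _; have := phiNy x; case E : (phi x) => [r| |//] _; last first.
    by exists 0%N => //=; rewrite E ltry.
  exists (Num.truncn `|r|).+1 => //=; rewrite E lte_fin ltrNl.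
  by apply: le_lt_trans (truncnS_gt _); rewrite -normrN ler_norm.
exists (- (\max_(i <- finmap.enum_fset D) i)%:R) => x.
have [x0|/ltW x0] := leP (phi x) 0%E; last first.
  by apply: le_trans x0; rewrite lee_fin oppr_le0.
have [n /= nD /ltW] := KD _ x0; apply: le_trans; rewrite lee_fin lerN2 ler_nat.
by apply: (@leq_bigmax_seq _ (finmap.enum_fset D) xpredT id).
Qed.

(** * The Boltzmann weight *)
Section boltzmann.
Context (R : realType) (N : nat) (phi : 'rV[R]_N -> \bar R) (eps m : R).
Hypotheses (eps0 : 0 < eps) (phi_m : forall x, (m%:E <= phi x)%E).
Notation tupR := (N.-tuple (measurableTypeR R)).

Definition boltzmann (y : tupR) : R :=
  fine (expeR (- (eps^-1%:E * phi (row_of_tuple y))))%E.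

Lemma boltzmann_ge0 y : 0 <= boltzmann y.
Proof. by rewrite fine_ge0// expeR_ge0. Qed.

Lemma boltzmannE y : (boltzmann y)%:E = expeR (- (eps^-1%:E * phi (row_of_tuple y))).
Proof.
rewrite fineK// /boltzmann; have := phi_m (row_of_tuple y).
by case: (phi _) => // _; rewrite gt0_muley ?lte_fin ?invr_gt0.
Qed.

(** The exponential form of the level matches [log_dominates], and the case phi = +oo needs
    no separate treatment. *)
Lemma lt_boltzmann s y :
  (expR s < boltzmann y) = (phi (row_of_tuple y) < (- (eps * s))%:E)%E.
Proof.
rewrite -lte_fin boltzmannE -[(expR s)%:E]/(expeR s%:E) lte_expeR.
have := phi_m (row_of_tuple y); case: (phi _) => [p _|_|//].
  by rewrite -EFinM -EFinN !lte_fin ltrNr mulrC ltr_pdivrMr// mulNr (mulrC eps).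
by rewrite gt0_muley ?lte_fin ?invr_gt0.
Qed.

Lemma boltzmann_le y : boltzmann y <= expR (- (eps^-1 * m)).
Proof.
rewrite -lee_fin boltzmannE -[(expR _)%:E]/(expeR (- (eps^-1 * m))%:E) lee_expeR.
by rewrite EFinN leeN2 EFinM lee_pmul2l// ?lte_fin ?invr_gt0.
Qed.

Lemma boltzmann_gt0 y : (phi (row_of_tuple y) < +oo)%E -> 0 < boltzmann y.
Proof.
move=> phiy; rewrite -lte_fin boltzmannE expeR_gt0//.
have := phi_m (row_of_tuple y); move: phiy; case: (phi _) => // p _ _.
by rewrite -EFinM -EFinN ltNyr.
Qed.

Lemma measurable_boltzmann : lower_semicontinuous phi -> measurable_fun setT boltzmann.
Proof.
move=> /measurable_lsc_row_of_tuple mphi.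
have mD : measurable [set y | (phi (row_of_tuple y) < +oo)%E].
  by rewrite -[X in measurable X]setTI; exact: emeasurable_fun_infty_o.
(* On the domain of phi the weight is a composite of measurable real
   functions; outside it vanishes, which the indicator enforces. *)
rewrite (_ : boltzmann = fun y => expR (- (eps^-1 * fine (phi (row_of_tuple y)))) *
    \1_[set y | (phi (row_of_tuple y) < +oo)%E] y).
  apply: measurable_funM; last exact: measurable_indic.
  apply: measurableT_comp => //; apply: measurableT_comp => //.
  apply: measurable_funM => //.
  exact: (measurableT_comp (fine_measurable measurableT) mphi).
apply/funext => y; apply: EFin_inj; rewrite boltzmannE indicE.
have := phi_m (row_of_tuple y); case E : (phi _) => [p| |//] _.
  by rewrite mem_set/= ?E ?ltry// mulr1.
by rewrite memNset/= ?E// gt0_muley ?lte_fin ?invr_gt0// mulr0.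
Qed.

Lemma integrandE k x y :
  expeR (- (eps^-1%:E * phi (row_of_tuple y)) - (k * sqnorm2 (x - row_of_tuple y))%:E)%E
  = (boltzmann y * gaussian k x y)%:E.
Proof. by rewrite expeRD [RHS]EFinM boltzmannE. Qed.

End boltzmann.

(** * Log-concavity of the smoothing and convexity of the solution *)

(** Convexity only has to be tested on real upper bounds of the values: the endpoints
    t = 0, 1 and the value +oo are covered by the conventions of extended reals. *)
Lemma convex_efun_levels (R : realType) N (h : 'rV[R]_N -> \bar R) :
  (forall x, h x <> -oo%E) ->
  (forall x y t a b, 0 < t < 1 -> (h x <= a%:E)%E -> (h y <= b%:E)%E ->
    (h (t *: x + (1 - t) *: y)%R <= (t * a + (1 - t) * b)%:E)%E) ->
  convex_efun h.
Proof.
move=> hNy hlev x y t /andP[]; rewrite le_eqVlt => /predU1P[<- _|t0].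
  by rewrite scale0r add0r subr0 scale1r mul0e add0e mul1e.
rewrite le_eqVlt => /predU1P[->|t1].
  by rewrite subrr scale0r addr0 scale1r mul0e adde0 mul1e.
have s0 : 0 < 1 - t by rewrite subr_gt0.
have := hlev x y t; have := hNy x; have := hNy y.
case: (h x) => [a| |//] ; case: (h y) => [b| |//] _ _ H.
- by apply: (H a b) => //; rewrite t0.
- by rewrite gt0_muley ?lte_fin// -EFinM addey// leey.
- by rewrite gt0_muley ?lte_fin// -EFinM addye// leey.
- by rewrite !gt0_muley ?lte_fin// leey.
Qed.

Lemma row_of_tuple_conv (R : realType) N t (u v : N.-tuple (measurableTypeR R)) :
  row_of_tuple (tuple_conv t u v) = t *: row_of_tuple u + (1 - t) *: row_of_tuple v.
Proof. by apply/rowP => i; rewrite !mxE tnth_mktuple. Qed.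

(** The value u = - eps log (I / Z) decreases with I; I = 0 corresponds to u = +oo. *)
Lemma entropy_level (R : realType) (eps Z a : R) (I : \bar R) :
  0 < eps -> 0 < Z -> (0 <= I)%E -> I \is a fin_num ->
  (- (eps%:E * lne (Z^-1%:E * I)) <= a%:E)%E = ((expR (ln Z - a / eps))%:E <= I)%E.
Proof.
move=> eps0 Z0; case: I => // r; rewrite lee_fin le_eqVlt => /predU1P[<- _|r0 _].
  rewrite mule0 le0_lneNy// gt0_muleNy ?lte_fin// leye_eq.
  by rewrite lee_fin leNgt expR_gt0.
rewrite -EFinM lne_EFin ?mulr_gt0 ?invr_gt0// -EFinM -EFinN !lee_fin.
rewrite lnM ?posrE ?invr_gt0// lnV// -[in RHS](@lnK _ r)// ler_expR.
rewrite lerNl mulrC -ler_pdivrMr// mulNr; apply/idP/idP; lra.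
Qed.

Section smoothing_boltzmann.
Context (R : realType) (N : nat) (phi : 'rV[R]_N -> \bar R) (eps m k : R).
Hypotheses (eps0 : 0 < eps) (k0 : 0 < k) (phi_m : forall x, (m%:E <= phi x)%E).
Hypotheses (lsc : lower_semicontinuous phi) (cvx : convex_efun phi).
Notation w := (boltzmann phi eps).
Notation tupR := (N.-tuple (measurableTypeR R)).

Let mw : measurable_fun setT w.
Proof. exact: (measurable_boltzmann eps0 phi_m lsc). Qed.

Let w0 y : 0 <= w y. Proof. exact: boltzmann_ge0. Qed.

(** On logarithms: phi / eps + k |.|^2 is convex along t (x1, u) + (1 - t) (x2, v). *)
Lemma log_dominates_boltzmann_gaussian (t : R) (x1 x2 : 'rV[R]_N) : 0 < t < 1 ->
  log_dominates (tuple_conv t) t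
    (fun y : tupR => (w y * gaussian k x1 y)%:E)
    (fun y : tupR => (w y * gaussian k x2 y)%:E)
    (fun y : tupR => (w y * gaussian k (t *: x1 + (1 - t) *: x2) y)%:E).
Proof.
move=> /andP[t0 t1] u v a b; rewrite !lte_fin /gaussian !expRN.
rewrite !ltr_pdivlMr ?expR_gt0// -!expRD !(lt_boltzmann eps0 phi_m).
rewrite row_of_tuple_conv; set q := sqnorm2 _; set q1 := sqnorm2 _.
set q2 := sqnorm2 _ => hu hv.
have q12 : q2 <= t * q + (1 - t) * q1.
  rewrite /q2 (_ : _ - _ = t *: (x1 - row_of_tuple u) + (1 - t) *: (x2 - row_of_tuple v)).
    by apply: sqnorm2_convex; rewrite !ltW.
  by rewrite !scalerBr opprD addrACA.
have t01 : 0 <= t <= 1 by rewrite !ltW.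
apply: le_lt_trans (cvx _ _ t01) _.
move: hu hv; have := phi_m (row_of_tuple u); have := phi_m (row_of_tuple v).
case: (phi _) => // p _; case: (phi _) => // p' _; rewrite -!EFinM -EFinD !lte_fin.
move=> h1 h2; have s0 : 0 < 1 - t by rewrite subr_gt0.
have H1 : t * p' < t * (- (eps * (a + k * q))) by rewrite ltr_pM2l.
have H2 : (1 - t) * p < (1 - t) * (- (eps * (b + k * q1))) by rewrite ltr_pM2l.
have H3 : eps * k * q2 <= eps * k * (t * q + (1 - t) * q1).
  by rewrite ler_wpM2l// ltW// mulr_gt0.
by lra.
Qed.

(** The Prékopa-Leindler inequality has strict bounds; lowering a and b by d gives
    the strict bound with a loss of d, and d is arbitrary. *)
Lemma smoothing_log_concave (t a b : R) (x1 x2 : 'rV[R]_N) : 0 < t < 1 ->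
  ((expR a)%:E <= smoothing k w x1)%E -> ((expR b)%:E <= smoothing k w x2)%E ->
  ((expR (t * a + (1 - t) * b))%:E <= smoothing k w (t *: x1 + (1 - t) *: x2)%R)%E.
Proof.
move=> t01 ha hb; set z := t *: x1 + _.
have mF x : measurable_fun setT (fun y : tupR => (w y * gaussian k x y)%:E : \bar R).
  by apply/measurable_EFinP; apply: measurable_funM => //; exact: measurable_gaussian.
have F0 x (y : tupR) : (0 <= (w y * gaussian k x y)%:E)%E.
  by rewrite lee_fin mulr_ge0 ?expR_ge0.
have lt d : 0 < d -> ((expR (t * a + (1 - t) * b - d))%:E < smoothing k w z)%E.
  move=> d0.
  have -> : t * a + (1 - t) * b - d = t * (a - d) + (1 - t) * (b - d) by ring.
  apply: (prekopa_leindler t01 (mF x1) (F0 x1) (mF x2) (F0 x2) (mF z) (F0 z)).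
  - exact: log_dominates_boltzmann_gaussian.
  - by apply: lt_le_trans ha; rewrite lte_fin ltr_expR ltrBlDr ltrDl.
  - by apply: lt_le_trans hb; rewrite lte_fin ltr_expR ltrBlDr ltrDl.
rewrite leNgt; apply/negP.
have := lt 1 ltr01; case E : (smoothing k w z) => [r| |] //; rewrite !lte_fin => r0.
have /expR_total[L Lr] : 0 < r by apply: lt_trans r0; exact: expR_gt0.
rewrite -Lr ltr_expR => Llt.
have := lt (t * a + (1 - t) * b - L); rewrite subr_gt0 => /(_ Llt).
by rewrite E -Lr subKr ltxx.
Qed.

End smoothing_boltzmann.

Lemma cole_hopfE (R : realType) N (eps m l : R) (phi : 'rV[R]_N -> \bar R) x :
  0 < eps -> (forall x, (m%:E <= phi x)%E) -> l != 0 ->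
  cole_hopf eps phi x l =
  (- (eps%:E * lne (((2 * pi * eps * l) `^ (N%:R / 2))^-1%:E *
        smoothing (2 * eps * l)^-1 (boltzmann phi eps) x)))%E.
Proof.
move=> eps0 phi_m /negbTE l0; rewrite /cole_hopf l0; congr (- (_ * lne (_ * _)))%E.
by apply: eq_integral => y _; exact: integrandE.
Qed.

Theorem proposition25 (R : realType) (N : nat) (phi : 'rV[R]_N -> \bar R)
    (phi_proper : proper_fun phi) (phi_lsc : lower_semicontinuous phi)
    (phi_convex : convex_efun phi) (phi_infc : inf_compact phi)
    (eps Lam : R) (eps_gt0 : 0 < eps) (Lam_gt0 : 0 < Lam)
    (l : R) (l_ge0 : 0 <= l) (l_le : l <= Lam) :
  [/\ (l = 0 \/ (effective_domain phi)° !=set0 ->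
         proper_fun (cole_hopf eps phi ^~ l)),
      lower_semicontinuous (cole_hopf eps phi ^~ l),
      convex_efun (cole_hopf eps phi ^~ l) &
      inf_compact (cole_hopf eps phi ^~ l)].
Proof.
have [l0|l0] := eqVneq l 0.
  rewrite l0; have -> : cole_hopf eps phi ^~ 0 = phi.
    by apply/funext => x; rewrite /cole_hopf eqxx.
  by split.
have {l0} l_gt0 : 0 < l by rewrite lt_neqAle eq_sym l0.
have [m phi_m] := inf_compact_lower_bound phi_proper.2 phi_lsc phi_infc.
pose k := (2 * eps * l)^-1.
have k0 : 0 < k by rewrite invr_gt0 !mulr_gt0.
pose Z := (2 * pi * eps * l) `^ (N%:R / 2).
have Z0 : 0 < Z by rewrite powR_gt0// !mulr_gt0 ?pi_gt0.
pose w := boltzmann phi eps.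
have mw : measurable_fun setT w by exact: (measurable_boltzmann eps_gt0 phi_m phi_lsc).
have w0 y : 0 <= w y by exact: boltzmann_ge0.
have wB y : w y <= expR (- (eps^-1 * m)) by exact: (boltzmann_le eps_gt0 phi_m).
have If x : smoothing k w x \is a fin_num by exact: (smoothing_fin_num k0 mw w0 wB).
have uE x := cole_hopfE x eps_gt0 phi_m (lt0r_neq0 l_gt0).
have lev x a : (cole_hopf eps phi x l <= a%:E)%E =
    ((expR (ln Z - a / eps))%:E <= smoothing k w x)%E.
  by rewrite uE entropy_level// smoothing_ge0.
have uNy x : cole_hopf eps phi x l <> -oo%E.
  (* Otherwise exp (log Z - a / eps) <= I(x) = r for all a, and some a
     makes the left side exp r. *)
  move=> ux.
  have lt a : ((expR (ln Z - a / eps))%:E <= smoothing k w x)%E by rewrite -lev ux leNye.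
  have /fineK Ix := If x; move: (fine _) Ix => r Ix.
  have := lt (eps * (ln Z - r)).
  rewrite -Ix lee_fin mulrAC divff ?gt_eqF// mul1r subKr leNgt.
  by rewrite (lt_le_trans _ (expR_ge1Dx _))// ltrDr.
have lscu : lower_semicontinuous (cole_hopf eps phi ^~ l).
  move=> x a; rewrite ltNge lev -ltNge => /(smoothing_usc k0 mw w0 wB) nx.
  by eexists; [exact: nx|move=> y /= Vy; rewrite ltNge lev -ltNge].
split => //.
- case=> [l0|[c /nbhs_ballP[r /= r0 rc]]]; first by rewrite l0 ltxx in l_gt0.
  split => //; exists c => uc.
  have : (0 < smoothing k w c)%E.
    apply: (@smoothing_gt0 _ _ _ _ c _ r) => // y yc.
    apply: (boltzmann_gt0 eps_gt0 phi_m); apply: rc.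
    by rewrite -ball_normE/= distrC.
  have /fineK Ix := If c; move: (fine _) Ix => q Ix.
  rewrite -Ix lte_fin => /expR_total[L Lq].
  have := lev c (eps * (ln Z - L)).
  by rewrite uc -Ix mulrAC divff ?gt_eqF// mul1r subKr Lq lexx.
- apply: convex_efun_levels => // x y t a b t01; rewrite !lev => xa yb.
  have := smoothing_log_concave eps_gt0 k0 phi_m phi_lsc phi_convex t01 xa yb.
  by congr ((expR _)%:E <= _)%E; ring.
- move=> a; apply: bounded_closed_compact.
    have [|r rI] := smoothing_vanish k0 mw w0 wB (expR_gt0 (ln Z - a / eps)).
      (* A weight above exp s means phi below - eps s: a compact set. *)
      move=> d /expR_total[s <-].
      have /compact_bounded[M [_ Mr]] := phi_infc (- (eps * s)).
      exists (M + 1) => y; rewrite (lt_boltzmann eps_gt0 phi_m) => /ltW ys.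
      by apply: (Mr (M + 1)) => //; rewrite ltrDl.
    exists r; split; first exact: num_real.
    move=> M rM x /=; rewrite lev => Ix; apply: le_trans (ltW rM).
    by rewrite leNgt; apply/negP => /rI; rewrite ltNge Ix.
  rewrite (_ : [set x | _] = ~` [set x | (a%:E < cole_hopf eps phi x l)%E]).
    by apply: open_closedC; move/lower_semicontinuousP : lscu; exact.
  by apply/seteqP; split => x /=; [rewrite leNgt => /negP|move/negP; rewrite -leNgt].
Qed.
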